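(* Let $S,S'\subseteq\omega$ be infinite sets containing $0$ which both satisfy condition (M) (for $T\in\{S,S'\}$: for every $p\in\omega$ there is $k\in\omega$ such that for every $q\in\omega$ there is $c\in\omega\cap[q,q+k]$ with $c+(T\cap[0,p])=T\cap(c+[0,p])$). Then: (a) if there is $p\in\omega$ such that for all $c\in\omega$, $c+(S\cap[0,p])\neq S'\cap(c+[0,p])$, then $A^S\not\leq^r_c A^{S'}$ and $A^{S'}\not\leq^r_c A^S$; (b) if there is $p\in\omega$ such that for all $c\in\omega$, $c-(S\cap[0,p])\neq S'\cap(c-[0,p])$, then $A^S\not\leq^r_c (A^{S'})^{-1}$ and $(A^{S'})^{-1}\not\leq^r_c A^S$.
   Context: For $c\in\omega$ and $F\subseteq\omega$: $c+F:=\{c+m:m\in F\}$, $c-F:=\{c-m:m\in F\}$ (as subsets of $\mathbb{Z}$). For $s\in 2^{<\omega}$, $\mathrm{Card}(s)$ is the number of $1$'s in $s$; $A^S:=\{(s0\gamma,s1\gamma): s\in 2^{<\omega},\ \mathrm{Card}(s)\in S,\ \gamma\in 2^\omega\}\subseteq 2^\omega\times 2^\omega$, and $(A^{S'})^{-1}:=\{(y,x):(x,y)\in A^{S'}\}$. For $A\subseteq 2^\omega\times 2^\omega$ and $A'\subseteq 2^\omega\times 2^\omega$, $A\leq^r_c A'$ means there are continuous $u,v:2^\omega\to 2^\omega$ with $A=(u\times v)^{-1}(A')$. *)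

(* Defs.v *)
From mathcomp Require Import all_boot all_order all_algebra.
From mathcomp Require Import mathcomp_extra boolp classical_sets functions cardinality.
From mathcomp Require Import reals topology cantor.

Set Implicit Arguments.
Unset Strict Implicit.
Unset Printing Implicit Defensive.

Local Open Scope classical_set_scope.

Definition interval0 (p : nat) : set nat := [set m | (m <= p)%N].

(* c + F; since c >= 0 and F is a set of naturals, it lies in nat. *)
Definition translate (c : nat) (F : set nat) : set nat :=
  [set (c + m)%N | m in F].

(* c - F as a set of integers: the subtraction is not truncated. *)
Definition reflection (c : nat) (F : set nat) : set int :=
  [set (c%:Z - m%:Z)%R | m in F].

Definition nat_in_int (F : set nat) : set int := [set m%:Z%R | m in F].

Definition condition_M (T : set nat) : Prop :=
  forall p : nat, exists k : nat, forall q : nat, exists c : nat,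
    (q <= c <= q + k)%N /\
    translate c (T `&` interval0 p) = T `&` translate c (interval0 p).

Definition Card (s : seq bool) : nat := count_mem true s.

(* The concatenation s gamma of a finite and an infinite binary sequence:
   the default value of nth supplies the terms of index >= size s. *)
Definition cat_cantor (s : seq bool) (gamma : cantor_space) : cantor_space :=
  fun n : nat => nth (gamma (n - size s)%N) s n.

Definition A_ (S : set nat) : set (cantor_space * cantor_space) :=
  [set xy | exists (s : seq bool) (gamma : cantor_space),
     S (Card s) /\
     xy = (cat_cantor (rcons s false) gamma, cat_cantor (rcons s true) gamma)].

Definition rel_inverse (A : set (cantor_space * cantor_space)) :
    set (cantor_space * cantor_space) :=
  [set (xy.2, xy.1) | xy in A].

Definition reducible_rc (A A' : set (cantor_space * cantor_space)) : Prop :=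
  exists u v : cantor_space -> cantor_space,
    [/\ continuous u, continuous v &
        A = (fun xy => (u xy.1, v xy.2)) @^-1` A'].

(* Main.v *)
(* Every point of the closure of A^{S'} outside A^{S'} is on the diagonal, while
   the diagonal lies in the closure of A^S, S being infinite; hence a reduction
   (u, v) satisfies u = v.  As 0 is in S, flipping the least 1 of a point of finite
   support is always an edge of A^S, so it flips one coordinate of the image under
   u.  Flipping a coordinate n tending to infinity moves the image less and less,
   so for n_1 << ... << n_{p+1} there are m_1 < ... < m_{p+1} such that
   u (0 + {n_j, ..., n_{p+1}}) = u 0 + {m_j, ..., m_{p+1}} for all j, and likewise
   without n_{p+1} and m_{p+1}.  Adding n_{p+1} on top of i ones is an edge of A^S
   iff S i, and the image pair is an edge iff S' (c + i), c being the number of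
   ones of u 0 below m_{p+1} (c - i if the target is the inverse of A^{S'}).  So
   the pattern of S on [0, p] occurs in S'.  Condition (M) for S turns the
   occurrence in S of a long enough pattern of S' into one of S in S'. *)
Require Import Defs.
From mathcomp Require Import all_boot all_order all_algebra.
From mathcomp Require Import mathcomp_extra boolp classical_sets functions cardinality.
From mathcomp Require Import reals topology cantor.
From mathcomp Require Import zify.

Local Open Scope classical_set_scope.

(** * Continuity through initial segments *)

Definition agree (N : nat) (x y : cantor_space) : Prop :=
  forall i, (i < N)%N -> x i = y i.

Lemma agreeW M N x y : (M <= N)%N -> agree N x y -> agree M x y.
Proof. by move=> MN xy i iM; apply: xy; exact: leq_trans MN. Qed.

(** The cylinders around [x] generate a filter converging to [x], and agreement below [M] is a
    finite intersection of open conditions. *)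
Lemma continuous_agree (u : cantor_space -> cantor_space) x M :
  continuous u -> exists N, forall y, agree N x y -> agree M (u x) (u y).
Proof.
move=> cu.
pose F := filter_from [set: nat] (fun N => [set y | agree N x y]).
have FF : Filter F.
  apply: filter_from_filter; first by exists 0%N.
  move=> i j _ _; exists (maxn i j) => // y xy.
  by split; apply: agreeW xy; [exact: leq_maxl|exact: leq_maxr].
have Fx : F --> x.
  apply/cvg_sup => i U [V] [[W] oW <-] /= Wx WU.
  by exists i.+1 => // y xy; apply: WU; rewrite /= /proj -xy.
suff [N _ Nu] : F [set y | agree M (u x) (u y)] by exists N.
apply: Fx; apply: cu => /=; elim: M => [|M IH].
  by apply: filterS filterT => y _ i.
have : nbhs (u x) [set y : cantor_space | u x M = y M].
  apply: (@proj_continuous nat (fun=> bool) M (u x)).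
  by apply: filterS (discrete_set1 _) => b ->.
apply: filterS2 IH => y yM ey i.
by rewrite ltnS leq_eqVlt => /orP[/eqP->//|]; exact: yM.
Qed.

Lemma continuous_agree_upto (u : cantor_space -> cantor_space)
    (f : nat -> cantor_space) k M :
  continuous u -> exists N, forall i y, (i <= k)%N ->
    agree N (f i) y -> agree M (u (f i)) (u y).
Proof.
move=> cu; elim: k => [|k [N IH]].
  have [N fN] := continuous_agree u (f 0%N) M cu.
  by exists N => i y; rewrite leqn0 => /eqP ->; exact: fN.
have [N' fN'] := continuous_agree u (f k.+1) M cu.
exists (maxn N' N) => i y; rewrite leq_eqVlt => /orP[/eqP->|ik] fy.
  by apply: fN'; apply: agreeW fy; exact: leq_maxl.
by apply: IH => //; apply: agreeW fy; exact: leq_maxr.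
Qed.

(** * Toggling coordinates and counting ones *)

Definition toggle (s : seq nat) (x : cantor_space) : cantor_space :=
  fun i => x i (+) (i \in s).

Definition ones (x : cantor_space) (n : nat) : nat := Card (mkseq x n).

Lemma onesS x n : ones x n.+1 = (ones x n + x n)%N.
Proof.
by rewrite /ones /Card mkseqS -cats1 count_cat /= addn0; case: (x n).
Qed.

Lemma eq_ones x y n : agree n x y -> ones x n = ones y n.
Proof.
elim: n => // n IH xy; rewrite !onesS IH ?xy //.
by move=> i ?; apply: xy; exact: ltnW.
Qed.

Lemma ones_toggle1 x j n : (j < n)%N ->
  (ones (toggle [:: j] x) n + x j = ones x n + ~~ x j)%N.
Proof.
elim: n => // n IH; rewrite ltnS leq_eqVlt !onesS => /orP[/eqP<-|jn].
  rewrite (eq_ones (toggle [:: j] x) x); last first.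
    by move=> i ij; rewrite /toggle mem_seq1 (ltn_eqF ij) addbF.
  by rewrite /toggle mem_seq1 eqxx addbT; lia.
by have := IH jn; rewrite [toggle [:: j] x n]/toggle mem_seq1 (gtn_eqF jn) addbF; lia.
Qed.

Lemma toggle_cons j s x : j \notin s ->
  toggle (j :: s) x = toggle [:: j] (toggle s x).
Proof.
move=> js; apply/funext => i; rewrite /toggle !inE.
by case: eqVneq => [->|]; rewrite ?(negbTE js) ?addbF.
Qed.

Lemma toggle_rcons n s x : n \notin s ->
  toggle (rcons s n) x = toggle [:: n] (toggle s x).
Proof.
move=> ns; rewrite -toggle_cons //; apply/funext => i.
by rewrite /toggle mem_rcons.
Qed.

Lemma toggle_nil x : toggle [::] x = x.
Proof. by apply/funext => i; rewrite /toggle addbF. Qed.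

(** All toggled coordinates have value [d], so the count moves by [size s] in one direction; stated
    with sums to avoid truncated subtraction. *)
Lemma ones_toggle d x s n : uniq s -> all (ltn^~ n) s ->
    all (fun i => x i == d) s ->
  (ones (toggle s x) n + d * size s = ones x n + ~~ d * size s)%N.
Proof.
elim: s => [|j s IH] /=; first by rewrite toggle_nil !muln0.
move=> /andP[js us] /andP[jn sn] /andP[/eqP xj xs].
have := IH us sn xs; have := ones_toggle1 (toggle s x) j n jn.
rewrite -toggle_cons // [toggle s x j]/toggle (negbTE js) addbF xj.
by case: d {IH xj xs} => /=; lia.
Qed.

(** * The relations as flips of one coordinate *)

(* [false] gives [A_ S], whose pairs flip a [0] to a [1]; [true] its inverse. *)
Definition Edge (d : bool) (S : set nat) (x y : cantor_space) : Prop :=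
  exists n, [/\ x n = d, y = toggle [:: n] x & S (ones x n)].

Lemma agree_toggle x n : agree n x (toggle [:: n] x).
Proof. by move=> i ni; rewrite /toggle mem_seq1 (ltn_eqF ni) addbF. Qed.

Lemma toggleK n : involutive (toggle [:: n]).
Proof. by move=> x; apply/funext => i; rewrite /toggle -addbA addbb addbF. Qed.

(** The flipped coordinate is not among those counted, so both points give the same count. *)
Lemma EdgeC S x y : Edge true S x y <-> Edge false S y x.
Proof.
have H d : Edge d S x y -> Edge (~~ d) S y x.
  move=> [n [xn -> Sn]]; exists n; split; last 2 first.
  - by rewrite toggleK.
  - by rewrite -(eq_ones _ _ _ (agree_toggle x n)).
  - by rewrite /toggle mem_seq1 eqxx addbT xn.
split; first exact: H.
move=> [n [yn -> Sn]]; exists n; split; last 2 first.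
- by rewrite toggleK.
- by rewrite -(eq_ones _ _ _ (agree_toggle y n)).
- by rewrite /toggle mem_seq1 eqxx addbT yn.
Qed.

Lemma A_Edge S x y : A_ S (x, y) <-> Edge false S x y.
Proof.
split=> [[s [g [Ss [-> ->]]]]|[n [xn -> Sn]]].
  exists (size s); split.
  - by rewrite /cat_cantor nth_rcons ltnn eqxx.
  - apply/funext => i; rewrite /toggle /cat_cantor mem_seq1 !nth_rcons.
    rewrite !size_rcons; case: ltngtP => // _; by rewrite addbF.
  - suff -> : ones (cat_cantor (rcons s false) g) (size s) = Card s by [].
    congr Card; apply: (@eq_from_nth _ false); rewrite size_mkseq // => i si.
    by rewrite nth_mkseq // /cat_cantor nth_rcons si; exact: set_nth_default.
(* Position [n] is the bit appended by [rcons], so the common tail starts at [n + 1]. *)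
exists (mkseq x n), (fun i => x (n + i.+1)%N); split => //.
congr pair; apply/funext => i;
  rewrite /cat_cantor nth_rcons size_mkseq size_rcons size_mkseq.
- case: ltngtP => [ni|ni|->//]; first by rewrite nth_mkseq.
  by congr x; lia.
- rewrite /toggle mem_seq1; case: ltngtP => [ni|ni|->].
  + by rewrite nth_mkseq // addbF.
  + by rewrite addbF; congr x; lia.
  + by rewrite xn.
Qed.

Lemma rel_inverseP A x y : rel_inverse A (x, y) <-> A (y, x).
Proof. by split=> [[[a b] /= Aab [<- <-]]//|Ayx]; exists (y, x). Qed.

Lemma rel_inverse_A_Edge S x y : rel_inverse (A_ S) (x, y) <-> Edge true S x y.
Proof. by rewrite EdgeC -A_Edge rel_inverseP. Qed.

Lemma Edge_toggle d S x n :
  Edge d S x (toggle [:: n] x) <-> x n = d /\ S (ones x n).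
Proof.
split=> [[m [xm e Sm]]|[xn Sn]]; last by exists n.
suff -> : n = m by [].
have := congr1 (fun z : cantor_space => z m) e.
rewrite /toggle !mem_seq1 eqxx; case: eqVneq => [->//|_].
by case: (x m).
Qed.

(** * Reductions have equal components *)

Lemma infinite_nat_ge (S : set nat) k :
  infinite_set S -> exists s, S s /\ (k <= s)%N.
Proof.
move=> Sinf; apply: contrapT => noS; apply: Sinf.
apply: sub_finite_set (finite_II k) => s Ss /=.
by rewrite ltnNge; apply/negP => ks; apply: noS; exists s.
Qed.

(** Ones placed from position [N] on raise the count below the flipped coordinate to a chosen
    element of [S]. *)
Lemma Edge_near S x N : infinite_set S ->
  exists y z, [/\ agree N x y, agree N x z & Edge false S y z].
Proof.
move=> /infinite_nat_ge -/(_ (ones x N))[s [Ss xs]].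
pose n := (N + (s - ones x N))%N.
pose y : cantor_space := fun i => if (i < N)%N then x i else (i < n)%N.
have xy : agree N x y by move=> i iN; rewrite /y iN.
have y_ones k : ones y (N + k)%N = (ones x N + minn k (s - ones x N))%N.
  elim: k => [|k IH]; first by rewrite addn0 min0n addn0 (eq_ones _ _ _ xy).
  by rewrite addnS onesS IH /y ltnNge leq_addr /= /n; lia.
exists y, (toggle [:: n] y); split=> //.
  by move=> i iN; rewrite (xy i iN); apply: agree_toggle; rewrite /n; lia.
apply/Edge_toggle; split; first by rewrite /y /n ltnn ltnNge leq_addr.
by rewrite /n y_ones minnn subnKC.
Qed.

(* The closure of [Edge d S'] adds only diagonal points, while the diagonal lies
   in the closure of [Edge false S] when [S] is infinite. *)
Lemma reduction_diagonal d S S' u v : infinite_set S ->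
  continuous u -> continuous v ->
  (forall x y, Edge false S x y <-> Edge d S' (u x) (v y)) ->
  u = v.
Proof.
move=> Sinf cu cv H; apply/funext => x; apply/funext => m.
apply: contrapT => uvm.
(* Edges close to [(x, x)] are mapped to edges; as [u x] and [v x] differ at [m], the coordinate
   flipped there must be [m]. *)
have near M : (m < M)%N -> exists y z,
    [/\ agree M (u x) y, agree M (v x) z, z = toggle [:: m] y, y m = d
      & S' (ones y m)].
  move=> mM.
  have [N1 uN1] := continuous_agree u x M cu.
  have [N2 vN2] := continuous_agree v x M cv.
  have [y [z [xy xz]]] := Edge_near S x (maxn N1 N2) Sinf.
  have uxy : agree M (u x) (u y).
    by apply: uN1; apply: agreeW xy; exact: leq_maxl.
  have vxz : agree M (v x) (v z).
    by apply: vN2; apply: agreeW xz; exact: leq_maxr.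
  move=> /H[n [yn zE Sn]].
  suff nm : n = m by exists (u y), (v z); rewrite -nm; split.
  apply: contrapT => nm; apply: uvm.
  rewrite (uxy _ mM) (vxz _ mM) zE /toggle mem_seq1; case: eqVneq => [mn|_].
    by case: nm.
  by rewrite addbF.
(* In the limit, [(u x, v x)] is itself an edge flipping [m], which would make [(x, x)] an edge. *)
have : Edge false S x x.
  apply/H; have [y [z [uy vz _ ym Sm]]] := near m.+1 (ltnSn m).
  exists m; split; first by rewrite uy.
    apply/funext => i.
    have [y' [z' [uy' vz' zE' _ _]]] := near (maxn m i).+1 (leq_maxl m i).
    have im : (i < (maxn m i).+1)%N by rewrite ltnS leq_maxr.
    by rewrite vz' // zE' /toggle uy'.
  suff -> : ones (u x) m = ones y m by [].
  by apply: eq_ones; exact: agreeW uy.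
move=> [n [xn xE _]]; have := congr1 (fun z : cantor_space => z n) xE.
by rewrite /toggle mem_seq1 eqxx xn.
Qed.

(** * Following finite sets of coordinates through a reduction *)

(* The bound on [c] rules out truncation in [c - i]. *)
Definition window (d : bool) (S S' : set nat) (p : nat) : Prop :=
  exists c, (d -> p <= c)%N /\
    forall i, (i <= p)%N -> S i <-> S' (if d then c - i else c + i)%N.

Definition zeros : cantor_space := fun=> false.

(** Consecutive final segments [drop i a] differ by their least element, so they form an edge once
    [S 0] holds. *)
Definition lifts (d : bool) (u : cantor_space -> cantor_space) (a b : seq nat) :=
  [/\ size a = size b, sorted ltn a, sorted ltn b,
      all (fun i => u zeros i == d) b &
      forall i, (i <= size a)%N ->
        u (toggle (drop i a) zeros) = toggle (drop i b) (u zeros)].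

Lemma Edge_toggle_min (S : set nat) k s : S 0%N -> all (ltn k) s ->
  Edge false S (toggle s zeros) (toggle (k :: s) zeros).
Proof.
move=> S0 ks.
have ksN : k \notin s by apply/negP => /(allP ks) /=; rewrite ltnn.
rewrite toggle_cons //; apply/Edge_toggle; rewrite /toggle (negbTE ksN).
split=> //; suff -> : ones (fun i => zeros i (+) (i \in s)) k = 0%N by [].
have : (k <= k)%N by [].
elim: {-2}k => // l IH lk; rewrite onesS IH ?(ltnW lk) //.
case: (boolP (l \in s)) => //= /(allP ks) /=; lia.
Qed.

Section Reduction.
Variables (d : bool) (S S' : set nat) (u : cantor_space -> cantor_space).
Hypotheses (S0 : S 0%N) (cu : continuous u).
Hypothesis uP : forall x y, Edge false S x y <-> Edge d S' (u x) (u y).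

(* Flipping the least coordinate is always an edge as [0] is in [S], and
   continuity determines which coordinate of the image it flips. *)
Lemma lifts_rcons_eq a b n m M : size a = size b ->
  sorted ltn a -> all (ltn^~ n) a ->
  sorted ltn b -> all (ltn^~ M) b -> (M <= m)%N ->
  u (toggle [:: n] zeros) = toggle [:: m] (u zeros) ->
  (forall i, (i <= size a)%N ->
    u (toggle (drop i a) zeros) = toggle (drop i b) (u zeros)) ->
  (forall i, (i <= size a)%N ->
    agree M (u (toggle (drop i a) zeros))
            (u (toggle (rcons (drop i a) n) zeros))) ->
  forall i, (i <= size a)%N ->
    u (toggle (rcons (drop i a) n) zeros)
      = toggle (rcons (drop i b) m) (u zeros).
Proof.
move=> + + + + + Mm unm; elim: a b => [|x a IH] [|y b] //= [sab].
rewrite !(path_sortedE ltn_trans).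
move=> /andP[xa sa] /andP[xn an] /andP[yb sb] /andP[yM bM] ab agr.
have {}IH := IH b sab sa an sb bM (fun i => ab i.+1) (fun i => agr i.+1).
case=> [_|i ia]; last exact: IH.
have := IH 0%N isT; rewrite !drop0 /= => uE.
have : Edge false S (toggle (rcons a n) zeros) (toggle (rcons (x :: a) n) zeros).
  by apply: Edge_toggle_min => //; rewrite all_rcons /= xn.
move=> /uP[k [_ + _]]; rewrite uE => kE; rewrite kE.
have ybm : y \notin rcons b m.
  rewrite mem_rcons inE negb_or; apply/andP; split.
    by apply/eqP => ym; move: yM Mm; rewrite /= ym; lia.
  by apply/negP => /(allP yb) /=; rewrite ltnn.
suff -> : k = y by rewrite -toggle_cons.
(* Adding [n] does not change the image below [M]; since [y] is below [M], it stays toggled, and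
   only [k = y] allows this. *)
have := agr 0%N isT y yM; rewrite (ab 0%N isT) !drop0 kE.
rewrite /toggle inE eqxx (negbTE ybm) addbF mem_seq1.
by case: eqVneq => // _; case: (u zeros y).
Qed.

Lemma lifts_rcons a b : lifts d u a b ->
  exists n m, [/\ all (ltn^~ n) a, all (ltn^~ m) b &
    lifts d u (rcons a n) (rcons b m)].
Proof.
move=> [sab sa sb db ab].
(* [M] exceeds all of [b], and [n] will be so large that adding it leaves the images unchanged below
   [M]; this forces [M <= m]. *)
pose M := (\max_(i <- b) i).+1.
have bM : all (ltn^~ M) b.
  by apply/allP => i ib /=; rewrite ltnS; exact: leq_bigmax_seq.
have [N agrN] :=
  continuous_agree_upto u (fun i => toggle (drop i a) zeros) (size a) M cu.
pose n := maxn N (\max_(i <- a) i).+1.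
have an : all (ltn^~ n) a.
  by apply/allP => i ia /=; rewrite leq_max ltnS leq_bigmax_seq ?orbT.
have anN i : n \notin drop i a.
  by apply/negP => /mem_drop /(allP an) /=; rewrite ltnn.
have agr i : (i <= size a)%N -> agree M (u (toggle (drop i a) zeros))
                                  (u (toggle (rcons (drop i a) n) zeros)).
  move=> ia; apply: (agrN _ _ ia); rewrite toggle_rcons //.
  by apply: agreeW (agree_toggle _ _); exact: leq_maxl.
have [m [wm um _]] : Edge d S' (u zeros) (u (toggle [:: n] zeros)).
  by apply/uP; rewrite -{1}[zeros]toggle_nil; exact: Edge_toggle_min.
have Mm : (M <= m)%N.
  rewrite leqNgt; apply/negP => mM; have := agr (size a) (leqnn _) m mM.
  rewrite drop_size toggle_nil um /toggle mem_seq1 eqxx.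
  by case: (u zeros m).
have bm : all (ltn^~ m) b.
  by apply: sub_all bM => i /= /leq_trans; exact.
exists n, m; split=> //; split.
- by rewrite !size_rcons sab.
- by rewrite (sorted_pairwise ltn_trans) pairwise_rcons an -(sorted_pairwise ltn_trans).
- by rewrite (sorted_pairwise ltn_trans) pairwise_rcons bm -(sorted_pairwise ltn_trans).
- by rewrite all_rcons wm eqxx.
- move=> i; rewrite size_rcons leq_eqVlt => /orP[/eqP->|].
    by rewrite !drop_oversize ?size_rcons ?sab // !toggle_nil.
  rewrite ltnS => ia; rewrite !drop_rcons -?sab //.
  exact: (lifts_rcons_eq a b n m M).
Qed.

Lemma lifts_ex k : exists a b, lifts d u a b /\ size a = k.
Proof.
elim: k => [|k [a [b [/lifts_rcons[n [m [_ _ ab]]] sa]]]].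
  by exists [::], [::]; split=> //; split=> // i _; rewrite !toggle_nil.
by exists (rcons a n), (rcons b m); rewrite size_rcons sa.
Qed.

Lemma reduction_window p : window d S S' p.
Proof.
have [a [b [ab sa]]] := lifts_ex p.
have [n [m [an bm abnm]]] := lifts_rcons a b ab.
case: ab => sab sorta sortb db ab.
case: abnm => _ _ _ + abnm; rewrite all_rcons => /andP[/eqP wm _].
have ua : uniq a by apply: sorted_uniq sorta; [exact: ltn_trans|exact: ltnn].
have ub : uniq b by apply: sorted_uniq sortb; [exact: ltn_trans|exact: ltnn].
(* The last [i] elements of [a] put exactly [i] ones below [n], so adding [n] is an edge iff [S i];
   the image pair flips [m]. *)
have key i : (i <= p)%N -> S i <->
    S' (ones (toggle (drop (p - i) b) (u zeros)) m).
  move=> ip; set j := (p - i)%N.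
  have ja : (j <= size a)%N by rewrite sa leq_subr.
  have nN : n \notin drop j a.
    by apply/negP => /mem_drop /(allP an) /=; rewrite ltnn.
  have mN : m \notin drop j b.
    by apply/negP => /mem_drop /(allP bm) /=; rewrite ltnn.
  have := uP (toggle (drop j a) zeros) (toggle (rcons (drop j a) n) zeros).
  have := abnm j; rewrite size_rcons leqW // !drop_rcons -?sab // => -> //.
  rewrite ab // !toggle_rcons // !Edge_toggle /toggle (negbTE nN) (negbTE mN).
  rewrite !addbF wm -/(toggle (drop j a) zeros) -/(toggle (drop j b) (u zeros)).
  have -> : ones (toggle (drop j a) zeros) n = i.
    have zn : ones zeros n = 0%N by elim: (n) => // k; rewrite onesS => ->.
    have dn : all (ltn^~ n) (drop j a).
      by apply/allP => k /mem_drop /(allP an).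
    have zj : all (fun k => zeros k == false) (drop j a) by apply/allP.
    have := ones_toggle false zeros (drop j a) n (drop_uniq j ua) dn zj.
    by rewrite size_drop sa zn /=; lia.
  by move=> [H1 H2]; split=> [Si|S'i]; [case: H1|case: H2].
(* [u zeros] equals [d] on [b]: toggling [i] elements of [b] removes [i] ones if [d] is true and
   adds [i] otherwise. *)
have cnt i : (i <= p)%N -> (ones (toggle (drop (p - i) b) (u zeros)) m + d * i
    = ones (u zeros) m + ~~ d * i)%N.
  move=> ip; have sz : size (drop (p - i) b) = i by rewrite size_drop -sab sa; lia.
  rewrite -{2 3}sz; apply: ones_toggle; first exact: drop_uniq.
    by apply/allP => k /mem_drop /(allP bm).
  by apply/allP => k /mem_drop /(allP db).
exists (ones (u zeros) m); split.
  by move=> dT; have := cnt p (leqnn p); rewrite dT; lia.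
move=> i ip; rewrite key //.
suff -> : ones (toggle (drop (p - i) b) (u zeros)) m =
  (if d then ones (u zeros) m - i else ones (u zeros) m + i)%N by [].
by have := cnt i ip; case: (d) => /=; lia.
Qed.

End Reduction.

(** * From reductions to common patterns of [S] and [S'] *)

Lemma reducible_window d S S' : infinite_set S -> S 0%N ->
  reducible_rc (A_ S) (if d then rel_inverse (A_ S') else A_ S') ->
  forall p, window d S S' p.
Proof.
move=> Sinf S0 [u [v [cu cv AE]]].
have uvP x y : Edge false S x y <-> Edge d S' (u x) (v y).
  by rewrite -A_Edge AE; case: (d) => /=; [exact: rel_inverse_A_Edge|exact: A_Edge].
have uv := reduction_diagonal d S S' u v Sinf cu cv uvP.
by apply: (reduction_window _ S S' u) => // x y; rewrite {2}uv.
Qed.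

(** Swapping coordinates exchanges [u] and [v]. *)
Lemma reducible_rel_inverse A B :
  reducible_rc (rel_inverse A) B -> reducible_rc A (rel_inverse B).
Proof.
move=> [u [v [cu cv AE]]]; exists v, u; split=> //.
apply/funext => -[x y]; apply/propext.
have := rel_inverseP A y x; rewrite AE => <-.
by symmetry; exact: rel_inverseP.
Qed.

Lemma translateP S S' c p :
  translate c (S `&` interval0 p) = S' `&` translate c (interval0 p) <->
  forall i, (i <= p)%N -> S i <-> S' (c + i)%N.
Proof.
split=> [E i ip|H].
  split=> Hi.
    have : translate c (S `&` interval0 p) (c + i)%N by exists i.
    by rewrite E => -[].
  have : (S' `&` translate c (interval0 p)) (c + i)%N.
    by split=> //; exists i.
  by rewrite -E => -[j [Sj _] /addnI <-].
apply/seteqP; split=> z => [[i [Si ip] <-]|[+ [i ip iE]]].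
  by split; [apply/H|exists i].
by rewrite -iE => S'i; exists i => //; split=> //; apply/H.
Qed.

(** As [p <= c], natural and integer differences agree on [[0, p]]. *)
Lemma reflection_eq (S S' : set nat) c p : (p <= c)%N ->
  (forall i, (i <= p)%N -> S i <-> S' (c - i)%N) ->
  reflection c (S `&` interval0 p)
    = nat_in_int S' `&` reflection c (interval0 p).
Proof.
move=> pc H; apply/seteqP; split=> z.
  move=> [i [Si ip] <-]; split; last by exists i.
  exists (c - i)%N; first exact/H.
  by rewrite -subzn //; exact: leq_trans pc.
move=> [[j S'j <-] [i ip]]; rewrite /interval0 /= in ip.
rewrite subzn ?(leq_trans ip) // => -[jE].
by exists i; [split=> //; apply/H; rewrite ?jE|rewrite subzn ?jE ?(leq_trans ip)].
Qed.

Lemma condition_M_window (d : bool) (S S' : set nat) : condition_M S ->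
  (forall p, window d S' S p) -> forall p, window d S S' p.
Proof.
move=> SM W p; have [k Sk] := SM p.
have [c [pc cW]] := W (p + k)%N.
case: d {W} pc cW => [/(_ isT) pc|_] cW.
  (* This start keeps the copy [[e, e + p]] inside [[c - p - k, c]], where [S] mirrors [S']. *)
  have [e [/andP[ce ec] /translateP eS]] := Sk (c - p - k)%N.
  exists (c - e)%N; split=> [_|i ip]; first by lia.
  rewrite eS // (cW (c - e - i)%N); last by lia.
  by have -> : (c - (c - e - i) = e + i)%N by lia.
(* Here the copy stays inside [[c, c + p + k]], where [S] repeats [S']. *)
have [e [/andP[ce ec] /translateP eS]] := Sk c.
exists (e - c)%N; split=> // i ip.
rewrite eS // (cW (e - c + i)%N); last by lia.
by have -> : (c + (e - c + i) = e + i)%N by lia.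
Qed.

Theorem theorem23 (S S' : set nat)
  (S_inf : infinite_set S) (S'_inf : infinite_set S')
  (S_0 : S 0%N) (S'_0 : S' 0%N)
  (S_M : condition_M S) (S'_M : condition_M S') :
  ((exists p : nat, forall c : nat,
      translate c (S `&` interval0 p) <> S' `&` translate c (interval0 p)) ->
    ~ reducible_rc (A_ S) (A_ S') /\ ~ reducible_rc (A_ S') (A_ S)) /\
  ((exists p : nat, forall c : nat,
      reflection c (S `&` interval0 p)
        <> nat_in_int S' `&` reflection c (interval0 p)) ->
    ~ reducible_rc (A_ S) (rel_inverse (A_ S')) /\ ~ reducible_rc (rel_inverse (A_ S')) (A_ S)).
Proof.
have fwd d := reducible_window d S S' S_inf S_0.
(* A reduction of the opposite direction places [S'] in [S]; condition (M) turns this around. *)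
have bwd d H :=
  condition_M_window d S S' S_M (reducible_window d S' S S'_inf S'_0 H).
split=> -[p np].
  split=> [/(fwd false)|/(bwd false)] /(_ p) [c [_ cP]];
    by apply: (np c); apply/translateP.
split=> [/(fwd true)|/reducible_rel_inverse/(bwd true)] /(_ p) [c [pc cP]];
  by apply: (np c); apply: reflection_eq => //; exact: pc.
Qed.
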